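(* Let $\Omega\subseteq\mathbb{R}^n$ be an open set. For a net $(u_\varepsilon)$ of functions in $\mathcal{C}^\infty(\Omega,\mathbb{R})$, indexed by $\varepsilon\in(0,1]$ in (i), (ii) and by $\varepsilon\in\hat I=\mathcal{D}(\mathbb{R}^d)$ in (iii), (iv): (i) $(u_\varepsilon)\in\mathcal{E}^{\mathrm{s}}_M(\Omega)$ if and only if $\forall K\Subset\Omega\ \forall\alpha\in\mathbb{N}^n\ \exists N\in\mathbb{N}:\ \sup_{x\in K}|\partial^\alpha u_\varepsilon(x)|=O(\varepsilon^{-N})$ as $\varepsilon\in\mathbb{I}^{\mathrm{s}}$; (ii) $(u_\varepsilon)\in\mathcal{N}^{\mathrm{s}}(\Omega)$ if and only if $\forall K\Subset\Omega\ \forall\alpha\in\mathbb{N}^n\ \forall m\in\mathbb{N}:\ \sup_{x\in K}|\partial^\alpha u_\varepsilon(x)|=O(\varepsilon^{m})$ as $\varepsilon\in\mathbb{I}^{\mathrm{s}}$; (iii) $(u_\varepsilon)\in\mathcal{M}(\mathcal{E}(\Omega)^{\mathcal{D}_0})$ if and only if $\forall K\Subset\Omega\ \forall\alpha\in\mathbb{N}^n\ \exists N\in\mathbb{N}:\ \sup_{x\in K}|\partial^\alpha u_\varepsilon(x)|=O(\underline{\varepsilon}^{-N})$ as $\varepsilon\in\hat{\mathbb{I}}$; (iv) $(u_\varepsilon)\in\mathcal{N}(\mathcal{E}(\Omega)^{\mathcal{D}_0})$ if and only if $\forall K\Subset\Omega\ \forall\alpha\in\mathbb{N}^n\ \forall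 m\in\mathbb{N}:\ \sup_{x\in K}|\partial^\alpha u_\varepsilon(x)|=O(\underline{\varepsilon}^{m})$ as $\varepsilon\in\hat{\mathbb{I}}$.
   Context: $\mathbb{N}=\{0,1,2,\dots\}$; $K\Subset\Omega$ means that $K$ is a compact subset of $\Omega$. Big-O. For a triple $\mathbb{I}=(I,\le,\mathcal{I})$ ($\le$ a pre-order on $I$, $\mathcal{I}$ a set of nonempty subsets of $I$), put $(\emptyset,e]:=\{\varepsilon\in I\mid\varepsilon\le e\}$ and $A_{\le e}:=(\emptyset,e]\cap A$. For real nets $(x_\varepsilon),(y_\varepsilon)\in\mathbb{R}^I$, ''$x_\varepsilon=O(y_\varepsilon)$ as $\varepsilon\in\mathbb{I}$'' means: there is $A\in\mathcal{I}$ such that for all $a\in A$ there are $H>0$ and $\varepsilon_0\in A_{\le a}$ with $|x_\varepsilon|\le H|y_\varepsilon|$ for all $\varepsilon\in A_{\le\varepsilon_0}$. The triple $\mathbb{I}^{\mathrm{s}}=(I^{\mathrm{s}},\le,\mathcal{I}^{\mathrm{s}})$: $I^{\mathrm{s}}=(0,1]$ with the usual order, $\mathcal{I}^{\mathrm{s}}=\{(0,\varepsilon_0]\mid\varepsilon_0\in(0,1]\}$. The triple $\hat{\mathbb{I}}=(\hat I,\le,\hat{\mathcal{I}})$: $\hat I=\mathcal{D}_0=\mathcal{D}(\mathbb{R}^d)$ ($d\ge1$) is the space of smooth compactly supported functions on $\mathbb{R}^d$; $\underline{\varphi}:=\mathrm{diam}(\mathrm{supp}(\varphi))$ if $\varphi\ne0$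 and $\underline{0}:=1$; $\varphi\le\psi$ iff $\underline\varphi\le\underline\psi$; and $\hat{\mathcal{I}}$ is a fixed free ultrafilter on $\mathcal{D}_0$ for which there are sets $\mathcal{D}_n\in\hat{\mathcal{I}}$ ($n\ge1$) with $\underline\varphi\le\frac1n$ for all $\varphi\in\mathcal{D}_n$. A property $\mathcal{P}(\varphi)$ holds almost everywhere (a.e.) if $\{\varphi\in\mathcal{D}_0\mid\mathcal{P}(\varphi)\}\in\hat{\mathcal{I}}$. Moderate and negligible nets. For nets indexed by $(0,1]$: $(u_\varepsilon)\in\mathcal{E}_M^{\mathrm{s}}(\Omega)$ iff $\forall K\Subset\Omega\,\forall\alpha\in\mathbb{N}^n\,\exists N\in\mathbb{N}$: $\sup_{x\in K}|\partial^\alpha u_\varepsilon(x)|=O(\varepsilon^{-N})$ as $\varepsilon\to0^+$ (usual Landau symbol); $(u_\varepsilon)\in\mathcal{N}^{\mathrm{s}}(\Omega)$ iff $\forall K\Subset\Omega\,\forall\alpha\in\mathbb{N}^n\,\forall m\in\mathbb{N}$: $\sup_{x\in K}|\partial^\alpha u_\varepsilon(x)|=O(\varepsilon^{m})$ as $\varepsilon\to0^+$. For nets indexed by $\mathcal{D}_0$: $(u_\varphi)\in\mathcal{M}(\mathcal{E}(\Omega)^{\mathcal{D}_0})$ iff $\forall K\Subset\Omega\,\forall\alpha\in\mathbb{N}^n\,\exists N\in\mathbb{N}\,\exists H>0$: $\sup_{x\in K}|\partial^\alpha u_\varphi(x)|\le H\underline{\varphi}^{-N}$ a.e.; $(u_\varphi)\in\mathcal{N}(\mathcal{E}(\Omega)^{\mathcal{D}_0})$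 iff $\forall K\Subset\Omega\,\forall\alpha\in\mathbb{N}^n\,\forall m\in\mathbb{N}\,\exists H>0$: $\sup_{x\in K}|\partial^\alpha u_\varphi(x)|\le H\underline{\varphi}^{m}$ a.e. *)

(* Defs.v *)
From HB Require Import structures.
From mathcomp Require Import all_boot all_order all_algebra.
From mathcomp Require Import all_classical all_reals all_analysis.

Set Implicit Arguments.
Unset Strict Implicit.
Unset Printing Implicit Defensive.
Import Order.TTheory GRing.Theory Num.Theory.
Import numFieldNormedType.Exports.
Local Open Scope classical_set_scope.
Local Open Scope ring_scope.

Record index_triple := IndexTriple {
  index :> Type;
  idx_le : index -> index -> Prop;
  idx_sets : set_system index;
  idx_le_refl : forall e, idx_le e e;
  idx_le_trans : forall e1 e2 e3, idx_le e1 e2 -> idx_le e2 e3 -> idx_le e1 e3;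
  idx_sets_nonempty : forall A, idx_sets A -> A !=set0 }.

Definition down (I : index_triple) (e : I) : set I := [set e' | idx_le e' e].

Definition big_O (R : realType) (I : index_triple) (x y : I -> R) : Prop :=
  exists2 A : set I, idx_sets A & forall a, A a ->
    exists2 H : R, 0 < H & exists2 e0 : I, (down a `&` A) e0 &
      forall e, (down e0 `&` A) e -> `|x e| <= H * `|y e|.

(* A function on Omega is represented by a
   total function whose values outside Omega are irrelevant: all notions below
   only evaluate derivatives at points of the open set Omega. *)

Section Smooth.
Variables (R : realType) (n : nat).
Implicit Types (f : 'rV[R]_n -> R) (Omega K : set 'rV[R]_n).

Definition partial (i : 'I_n) f : 'rV[R]_n -> R := 'D_(delta_mx 0 i) f.

Definition mpartial (alpha : 'I_n -> nat) f : 'rV[R]_n -> R :=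
  foldr (fun i g => iter (alpha i) (partial i) g) f (enum 'I_n).

Definition smooth_on Omega f : Prop :=
  forall (s : seq 'I_n) x, Omega x ->
    {for x, continuous (foldr partial f s)} /\
    forall i, derivable (foldr partial f s) x (delta_mx 0 i).

Record Cinfty Omega := MkCinfty {
  Cinfty_fun :> 'rV[R]_n -> R;
  Cinfty_smooth : smooth_on Omega Cinfty_fun }.

(* The real-valued sup is 0 when K is empty. *)
Definition sup_partial K (alpha : 'I_n -> nat) f : R :=
  sup [set `|mpartial alpha f x| | x in K].

End Smooth.

Section TestFunctions.
Variables (R : realType) (d : nat).

Definition supp (f : 'rV[R]_d -> R) : set 'rV[R]_d := closure [set x | f x != 0].

Record testfun := MkTestfun {
  testfun_fun :> 'rV[R]_d -> R;
  testfun_smooth : smooth_on setT testfun_fun;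
  testfun_supp : compact (supp testfun_fun) }.

(* The library norm on row vectors is the maximum norm; the diameter is taken
   for the Euclidean one. *)
Definition euclidean_norm (x : 'rV[R]_d) : R := Num.sqrt (\sum_i x 0 i ^+ 2).

Definition diam (A : set 'rV[R]_d) : R :=
  sup [set euclidean_norm (x - y) | x in A & y in A].

Definition size_of (phi : testfun) : R :=
  if pselect (testfun_fun phi = cst 0) then 1 else diam (supp phi).

End TestFunctions.

Section SpecialTriple.
Variable R : realType.

Definition I01 := {e : R | `]0, 1]%classic e}.

Fact Is_nonempty (A : set I01) :
  range (fun e0 : I01 => [set e : I01 | sval e <= sval e0]) A -> A !=set0.
Proof. by case=> e0 _ <-; exists e0 => /=. Qed.

Definition Is : index_triple :=
  @IndexTriple I01 (fun e1 e2 => sval e1 <= sval e2)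
    (range (fun e0 : I01 => [set e : I01 | sval e <= sval e0]))
    (fun e => lexx (sval e))
    (fun e1 e2 e3 => @le_trans _ _ (sval e2) (sval e1) (sval e3))
    Is_nonempty.

(* The filter "eps -> 0+", restricted to the index set (0, 1]. *)
Definition to0 : set_system I01 := subset_filter 0^'+ `]0, 1]%classic.

Global Instance to0_filter : Filter to0.
Proof. exact: subset_filter_filter. Qed.

Canonical to0_filter_on := FilterType to0 to0_filter.

End SpecialTriple.
Arguments to0 {R}.

Section FullTriple.
Variables (R : realType) (d : nat).
Variables (F : set_system (testfun R d)) (FU : UltraFilter F).

Definition Ihat : index_triple :=
  @IndexTriple (testfun R d) (fun phi psi => size_of phi <= size_of psi) F
    (fun phi => lexx (size_of phi))
    (fun phi1 phi2 phi3 =>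
       @le_trans _ _ (size_of phi2) (size_of phi1) (size_of phi3))
    (@filter_ex _ F ultra_proper).

End FullTriple.

Section Nets.
Variables (R : realType) (n : nat) (Omega : set 'rV[R]_n).

Definition moderate_s : set (I01 R -> Cinfty Omega) :=
  [set u : I01 R -> Cinfty Omega | forall K, compact K -> K `<=` Omega -> forall alpha : 'I_n -> nat,
    exists N : nat,
      (fun e => sup_partial K alpha (u e) : R^o)
        =O_to0 (fun e => sval e ^- N : R^o)].

Definition negligible_s : set (I01 R -> Cinfty Omega) :=
  [set u : I01 R -> Cinfty Omega | forall K, compact K -> K `<=` Omega -> forall (alpha : 'I_n -> nat)
    (m : nat),
      (fun e => sup_partial K alpha (u e) : R^o)
        =O_to0 (fun e => sval e ^+ m : R^o)].

Variables (d : nat) (F : set_system (testfun R d)).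

Definition moderate_hat : set (testfun R d -> Cinfty Omega) :=
  [set u : testfun R d -> Cinfty Omega | forall K, compact K -> K `<=` Omega -> forall alpha : 'I_n -> nat,
    exists N : nat, exists2 H : R, 0 < H &
      \forall phi \near F, sup_partial K alpha (u phi) <= H * size_of phi ^- N].

Definition negligible_hat : set (testfun R d -> Cinfty Omega) :=
  [set u : testfun R d -> Cinfty Omega | forall K, compact K -> K `<=` Omega -> forall (alpha : 'I_n -> nat)
    (m : nat), exists2 H : R, 0 < H &
      \forall phi \near F, sup_partial K alpha (u phi) <= H * size_of phi ^+ m].

End Nets.

(* Main.v *)
Require Import Defs.
From HB Require Import structures.
From mathcomp Require Import all_boot all_order all_algebra.
From mathcomp Require Import all_classical all_reals all_analysis.

Set Implicit Arguments.
Unset Strict Implicit.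
Unset Printing Implicit Defensive.
Import Order.TTheory GRing.Theory Num.Theory.
Import numFieldNormedType.Exports.
Local Open Scope classical_set_scope.
Local Open Scope ring_scope.

(** Each of the four equivalences compares two ways of saying that a bound
    [`|x e| <= H * `|y e|] holds for all sufficiently small indices: through
    the quantified [big_O] of an index triple, or through one filter [G] on the
    index set. The two agree as soon as the distinguished sets of the triple
    and the filter are cofinal in each other ([big_O_nearP]): every
    [G]-large set contains a distinguished set, and every truncation
    [A_(<= e0)] of a distinguished set [A] at one of its points is [G]-large.

    For the index set [(0, 1]] the filter is that of right neighbourhoods
    of [0], and the truncations are the intervals [(0, e0]]. For test functions
    the filter is the ultrafilter itself, and it only remains to see that
    [[set phi | size_of phi <= size_of e0]] belongs to it. This set contains
    [D k] as soon as [k^-1 <= size_of e0], so the point is that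
    [0 < size_of e0] ([size_of_gt0]). For the zero function the size is [1]
    by convention; otherwise the support of a nonzero continuous
    function on a space of dimension at least one contains two distinct points,
    and its diameter is finite by compactness. *)

Lemma big_O_nearP (R : realType) (I : index_triple) (G : set_system I)
    (x y : I -> R) :
  (forall (A : set I) (e0 : I), idx_sets A -> A e0 ->
     G (Defs.down e0 `&` A)) ->
  (forall P, G P -> exists2 A : set I, idx_sets A & A `<=` P) ->
  Filter G ->
  big_O x y <->
  exists2 H : R, 0 < H & \forall e \near G, `|x e| <= H * `|y e|.
Proof.
move=> downG Gsets FG; split.
  case=> A IA bnd; have [a Aa] := idx_sets_nonempty IA.
  have [H H0 [e0 [_ Ae0] He0]] := bnd a Aa.
  by exists H => //; apply: filterS (downG A e0 IA Ae0) => e; exact: He0.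
case=> H H0 /Gsets[A IA sAP]; exists A => // a Aa.
exists H => //; exists a; first by split=> //; exact: idx_le_refl.
by move=> e [_ /sAP].
Qed.

(** [S] may be empty or unbounded above: [sup S] is then the default [0]. *)
Lemma sup_ge0 (R : realType) (S : set R) : lbound S 0 -> 0 <= sup S.
Proof.
move=> S0; have [supS|/sup_out -> //] := pselect (has_sup S).
have [z Sz] := supS.1; apply: le_trans (S0 z Sz) _.
exact: ub_le_sup supS.2 z Sz.
Qed.

Lemma sup_partial_ge0 (R : realType) (n : nat) (K : set 'rV[R]_n)
    (alpha : 'I_n -> nat) (f : 'rV[R]_n -> R) : 0 <= sup_partial K alpha f.
Proof. by apply: sup_ge0 => _ [x _ <-]; exact: normr_ge0. Qed.

Section Special.
Variable R : realType.

(** The intervals [(0, e0]] form a base of the filter [to0]. *)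
Lemma to0P (P : set (I01 R)) :
  to0 P <-> exists e0 : I01 R, forall e, sval e <= sval e0 -> P e.
Proof.
split; last first.
  case=> -[e0 e0I] /= Pe0; move: (e0I); rewrite /= in_itv /= => /andP[e0_gt0 _].
  rewrite /to0 /subset_filter /=; near=> z => zI; apply: Pe0 => /=.
  by near: z; exact: nbhs_right_le.
(* Halving the radius turns the open ball into a closed interval, and the
   minimum with 1 keeps its endpoint in the index set. *)
move=> /nbhs_ballP[r /= r0 rP]; have e0I : `]0, 1]%classic (Num.min (r / 2) 1).
  by rewrite /= in_itv /= lt_min ge_min lexx ltr01 divr_gt0 //= orbT.
exists (exist _ _ e0I) => -[e eI] /=; rewrite le_min => /andP[er _].
have e0 : 0 < e by move: (eI); rewrite /= in_itv /= => /andP[].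
apply: rP => //=; rewrite /ball /= sub0r normrN gtr0_norm //.
by rewrite (le_lt_trans er)// gtr_pMr// invf_lt1 ?ltr1n.
Unshelve. all: by end_near. Qed.

(** On [(0, 1]] the big-O of the index triple is the usual Landau symbol. *)
Lemma Is_big_OP (x y : I01 R -> R) :
  @big_O R (Is R) x y <-> (x : I01 R -> R^o) =O_to0 (y : I01 R -> R^o).
Proof.
rewrite (@big_O_nearP R (Is R) to0).
- split.
    by case=> H H0 xy; apply/eqO_exP; exists H.
  by move=> /eqO_exP[H H0 xy]; exists H.
- move=> _ e0 [e1 _ <-] /= e01; apply/to0P; exists e0 => e ee0.
  by split=> //; exact: le_trans ee0 e01.
- move=> P /to0P[e0 Pe0]; exists [set e : I01 R | sval e <= sval e0].
    by exists e0.
  exact: Pe0.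
Qed.

End Special.

Section Full.
Variables (R : realType) (d : nat).

Lemma euclidean_norm_gt0 (x : 'rV[R]_d) : x != 0 -> 0 < euclidean_norm x.
Proof.
move=> x0; rewrite sqrtr_gt0 lt_neqAle sumr_ge0 ?andbT; last first.
  by move=> i _; exact: sqr_ge0.
apply: contra x0; rewrite eq_sym psumr_eq0; last first.
  by move=> i _; exact: sqr_ge0.
move=> /allP x0; apply/eqP/rowP => i; rewrite mxE.
by have /implyP/(_ isT) := x0 i (mem_index_enum i); rewrite sqrf_eq0 => /eqP.
Qed.

(** The norm on the right is the maximum norm. *)
Lemma le_euclidean_norm (x : 'rV[R]_d) :
  euclidean_norm x <= Num.sqrt (d%:R * `|x| ^+ 2).
Proof.
apply: ler_wsqrtr; rewrite mulr_natl -[d in _ *+ d]card_ord -sumr_const.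
apply: ler_sum => i _; rewrite -[leLHS]real_normK ?num_real//.
rewrite lerXn2r ?nnegrE// /Num.norm/= mx_normrE.
exact: (le_bigmax_cond _ (fun ij => `|x ij.1 ij.2|) (isT : xpredT (0, i))).
Qed.

Lemma compact_has_ubound_diam (A : set 'rV[R]_d) : compact A ->
  has_ubound [set euclidean_norm (x - y) | x in A & y in A].
Proof.
move=> /compact_bounded[M [_ AM]]; pose N := M + 1.
have AN x : A x -> `|x| <= N by apply: AM; rewrite ltrDl.
exists (Num.sqrt (d%:R * (N + N) ^+ 2)) => _ [x Ax [y Ay <-]].
apply: le_trans (le_euclidean_norm _) _; apply: ler_wsqrtr.
apply: ler_wpM2l => //; have xyN : `|x - y| <= N + N.
  by apply: le_trans (ler_normB _ _) _; exact: lerD (AN x Ax) (AN y Ay).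
by rewrite lerXn2r ?nnegrE// (le_trans _ xyN).
Qed.

(** The dimension must be positive: a nonzero function on a point has a
    support of diameter [0]. *)
Lemma size_of_gt0 (phi : testfun R d) : (1 <= d)%N -> 0 < size_of phi.
Proof.
move=> d1; rewrite /size_of; case: pselect => // phi_neq0.
have [x phix] : exists x, phi x != 0.
  apply: contrapT => /forallNP phi0; apply: phi_neq0; apply/funext => x.
  by have /negP/negPn/eqP := phi0 x.
have [cphi _] := @testfun_smooth _ _ phi [::] x I.
have phi_near : \forall y \near x, phi y != 0 by exact: cvgr_neq0 cphi phix.
have [r /= r0 phir] : exists2 r : R, 0 < r & forall y, `|x - y| < r -> phi y != 0.
  by move: phi_near => /nbhs_normP[r /= r0 rphi]; exists r.
(* The points [x] and [x - v] of the support are distinct; all entries of [v]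
   are [r / 2], so that its maximum norm is less than [r]. *)
pose v : 'rV[R]_d := const_mx (r / 2).
have v_neq0 : v != 0.
  apply/eqP => /rowP/(_ (Ordinal d1)); rewrite !mxE => /eqP.
  by rewrite gt_eqF// divr_gt0.
have v_lt : `|v| < r.
  rewrite (@le_lt_trans _ _ (r / 2))//; last first.
    by rewrite gtr_pMr// invf_lt1 ?ltr1n.
  rewrite /Num.norm/= mx_normrE; apply: bigmax_le; first by rewrite divr_ge0// ltW.
  by move=> i _; rewrite mxE ger0_norm// divr_ge0// ltW.
have phixv : phi (x - v) != 0 by apply: phir; rewrite opprB addrC subrK.
apply: lt_le_trans (euclidean_norm_gt0 v_neq0) _.
apply: ub_le_sup; first exact/compact_has_ubound_diam/testfun_supp.
exists x; first exact: subset_closure.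
exists (x - v); first exact: subset_closure.
by rewrite opprB addrC subrK.
Qed.

(** For nonnegative nets, the big-O of the index triple of test functions is an
    estimate holding almost everywhere. *)
Lemma Ihat_big_OP (F : set_system (testfun R d)) (FU : UltraFilter F)
    (x y : testfun R d -> R) : (1 <= d)%N ->
  (exists D : nat -> set (testfun R d), forall k, (1 <= k)%N ->
     F (D k) /\ forall phi, D k phi -> size_of phi <= k%:R^-1) ->
  (forall phi, 0 <= x phi) -> (forall phi, 0 <= y phi) ->
  @big_O R (Ihat FU) x y <->
  exists2 H : R, 0 < H & \forall phi \near F, x phi <= H * y phi.
Proof.
move=> d1 [D FD] x0 y0; rewrite (@big_O_nearP R (Ihat FU) F).
- by split=> -[H H0 xy]; exists H => //; apply: filterS xy => phi;
    rewrite !ger0_norm.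
- move=> A e0 /= FA Ae0; apply: filterI => //.
  have s0 : 0 < size_of e0 by exact: size_of_gt0.
  (* An index [k] with [k^-1 <= size_of e0]. *)
  have [FDk Dk] := FD (Num.truncn (size_of e0)^-1).+1 isT.
  apply: filterS FDk => phi /Dk /= phik; apply: le_trans phik _.
  by rewrite invf_ple ?posrE// ltW// truncnS_gt.
- by move=> P FP; exists P.
Qed.

End Full.

Theorem corollary17 (R : realType) (n d : nat) (d_ge1 : (1 <= d)%N)
    (Omega : set 'rV[R]_n) (Omega_open : open Omega)
    (F : set_system (testfun R d)) (FU : UltraFilter F)
    (F_free : \bigcap_(A in F) A = set0)
    (F_small : exists D : nat -> set (testfun R d), forall k, (1 <= k)%N ->
       F (D k) /\ forall phi, D k phi -> size_of phi <= k%:R^-1) :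
  (forall u : Is R -> Cinfty Omega,
     (moderate_s u <->
        forall K, compact K -> K `<=` Omega -> forall alpha : 'I_n -> nat,
          exists N : nat,
            @big_O R (Is R) (fun e => sup_partial K alpha (u e))
                            (fun e => sval e ^- N)) /\
     (negligible_s u <->
        forall K, compact K -> K `<=` Omega -> forall (alpha : 'I_n -> nat)
          (m : nat),
            @big_O R (Is R) (fun e => sup_partial K alpha (u e))
                            (fun e => sval e ^+ m))) /\
  (forall u : Ihat FU -> Cinfty Omega,
     (moderate_hat F u <->
        forall K, compact K -> K `<=` Omega -> forall alpha : 'I_n -> nat,
          exists N : nat,
            @big_O R (Ihat FU) (fun phi => sup_partial K alpha (u phi))
                               (fun phi => size_of phi ^- N)) /\
     (negligible_hat F u <->
        forall K, compact K -> K `<=` Omega -> forall (alpha : 'I_n -> nat)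
          (m : nat),
            @big_O R (Ihat FU) (fun phi => sup_partial K alpha (u phi))
                               (fun phi => size_of phi ^+ m))).
Proof.
have size_ge0 phi : 0 <= @size_of R d phi by rewrite ltW ?size_of_gt0.
have size_exprn_ge0 m phi : 0 <= @size_of R d phi ^+ m by rewrite exprn_ge0.
have size_exprVn_ge0 N phi : 0 <= @size_of R d phi ^- N by rewrite invr_ge0.
have sup_ge0' K alpha (u : testfun R d -> Cinfty Omega) phi :
  0 <= sup_partial K alpha (u phi) by exact: sup_partial_ge0.
split=> u; split; split=> mu K cK KO alpha.
- by have [N uN] := mu K cK KO alpha; exists N; exact/Is_big_OP.
- by have [N uN] := mu K cK KO alpha; exists N; exact/Is_big_OP.
- by move=> m; apply/Is_big_OP; exact: mu.
- by move=> m; apply/Is_big_OP; exact: mu.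
- by have [N uN] := mu K cK KO alpha; exists N; exact/Ihat_big_OP.
- by have [N uN] := mu K cK KO alpha; exists N; exact/(Ihat_big_OP FU).
- by move=> m; apply/Ihat_big_OP => //; exact: mu.
- by move=> m; apply/(Ihat_big_OP FU) => //; exact: mu.
Qed.
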